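(* Let $(\mathcal{A},\cdot,\alpha_{\mathcal{A}})$ and $(\mathcal{B},\circ,\alpha_{\mathcal{B}})$ be two hom-center-symmetric algebras. Suppose there are linear maps $l_{\mathcal{A}},r_{\mathcal{A}}:\mathcal{A}\to\mathfrak{gl}(\mathcal{B})$ and $l_{\mathcal{B}},r_{\mathcal{B}}:\mathcal{B}\to\mathfrak{gl}(\mathcal{A})$ such that $(l_{\mathcal{A}},r_{\mathcal{A}},\mathcal{B},\alpha_{\mathcal{B}})$ is a bimodule of $(\mathcal{A},\alpha_{\mathcal{A}})$, $(l_{\mathcal{B}},r_{\mathcal{B}},\mathcal{A},\alpha_{\mathcal{A}})$ is a bimodule of $(\mathcal{B},\alpha_{\mathcal{B}})$, and the following conditions hold for all $x,y\in\mathcal{A}$ and $a,b\in\mathcal{B}$: $$(l_{\mathcal{B}}(a)x)\cdot\alpha_{\mathcal{A}}(y)+l_{\mathcal{B}}(r_{\mathcal{A}}(x)a)(\alpha_{\mathcal{A}}(y))-l_{\mathcal{B}}(\alpha_{\mathcal{B}}(a))(x\cdot y)-r_{\mathcal{B}}(\alpha_{\mathcal{B}}(a))(y\cdot x)+\alpha_{\mathcal{A}}(y)\cdot(r_{\mathcal{B}}(a)x)+r_{\mathcal{B}}(l_{\mathcal{A}}(x)a)(\alpha_{\mathcal{A}}(y))=0,$$ $$\begin{aligned}&(r_{\mathcal{B}}(a)x)\cdot\alpha_{\mathcal{A}}(y)+l_{\mathcal{B}}(l_{\mathcal{A}}(x)a)(\alpha_{\mathcal{A}}(y))-\alpha_{\mathcal{A}}(x)\cdot(l_{\mathcal{B}}(a)y)-r_{\mathcal{B}}(r_{\mathcal{A}}(y)a)(\alpha_{\mathcal{A}}(x))\\&-(r_{\mathcal{B}}(a)y)\cdot\alpha_{\mathcal{A}}(x)-l_{\mathcal{B}}(l_{\mathcal{A}}(y)a)(\alpha_{\mathcal{A}}(x))+\alpha_{\mathcal{A}}(y)\cdot(l_{\mathcal{B}}(a)x)+r_{\mathcal{B}}(r_{\mathcal{A}}(x)a)(\alpha_{\mathcal{A}}(y))=0,\end{aligned}$$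 $$(l_{\mathcal{A}}(x)a)\circ\alpha_{\mathcal{B}}(b)+l_{\mathcal{A}}(r_{\mathcal{B}}(a)x)(\alpha_{\mathcal{B}}(b))-l_{\mathcal{A}}(\alpha_{\mathcal{A}}(x))(a\circ b)-r_{\mathcal{A}}(\alpha_{\mathcal{A}}(x))(b\circ a)+\alpha_{\mathcal{B}}(b)\circ(r_{\mathcal{A}}(x)a)+r_{\mathcal{A}}(l_{\mathcal{B}}(a)x)(\alpha_{\mathcal{B}}(b))=0,$$ $$\begin{aligned}&(r_{\mathcal{A}}(x)a)\circ\alpha_{\mathcal{B}}(b)+l_{\mathcal{A}}(l_{\mathcal{B}}(a)x)(\alpha_{\mathcal{B}}(b))-\alpha_{\mathcal{B}}(a)\circ(l_{\mathcal{A}}(x)b)-r_{\mathcal{A}}(r_{\mathcal{B}}(b)x)(\alpha_{\mathcal{B}}(a))\\&-(r_{\mathcal{A}}(x)b)\circ\alpha_{\mathcal{B}}(a)-l_{\mathcal{A}}(l_{\mathcal{B}}(b)x)(\alpha_{\mathcal{B}}(a))+\alpha_{\mathcal{B}}(b)\circ(l_{\mathcal{A}}(x)a)+r_{\mathcal{A}}(r_{\mathcal{B}}(a)x)(\alpha_{\mathcal{B}}(b))=0.\end{aligned}$$ Then there is a hom-center-symmetric algebra structure on the vector space $\mathcal{A}\oplus\mathcal{B}$, with twist map $\alpha_{\mathcal{A}}\oplus\alpha_{\mathcal{B}}$, given by $$(x+a)\ast(y+b)=(x\cdot y+l_{\mathcal{B}}(a)y+r_{\mathcal{B}}(b)x)+(a\circ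 b+l_{\mathcal{A}}(x)b+r_{\mathcal{A}}(y)a).$$
   Context: All vector spaces are over a field $\mathbb{K}$; $\mathfrak{gl}(V)$ denotes the space of linear endomorphisms of $V$. A hom-center-symmetric algebra is a triple $(\mathcal{A},\mu,\alpha)$ (with $xy=\mu(x,y)$) with $\mathcal{A}$ a vector space, $\mu:\mathcal{A}\otimes\mathcal{A}\to\mathcal{A}$ bilinear and $\alpha\in\mathfrak{gl}(\mathcal{A})$ such that for all $x,y,z\in\mathcal{A}$: $\alpha(xy)=\alpha(x)\alpha(y)$ and $(x,y,z)_\alpha=(z,y,x)_\alpha$, where $(x,y,z)_\alpha:=(xy)\alpha(z)-\alpha(x)(yz)$. For linear maps $l,r:\mathcal{A}\to\mathfrak{gl}(V)$ ($l_x=l(x)$, $r_x=r(x)$) and $\varphi\in\mathfrak{gl}(V)$, $(l,r,V,\varphi)$ is a bimodule of $(\mathcal{A},\alpha)$ if for all $x,y\in\mathcal{A}$: $\varphi\circ l_x=l_{\alpha(x)}\circ\varphi$, $\ \varphi\circ r_x=r_{\alpha(x)}\circ\varphi$; $l_{\alpha(x)}\circ l_y-l_{xy}\circ\varphi=r_{yx}\circ\varphi-r_{\alpha(x)}\circ r_y$; $l_{\alpha(x)}\circ r_y-r_{\alpha(y)}\circ l_x=l_{\alpha(y)}\circ r_x-r_{\alpha(x)}\circ l_y$. *)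

(* Defs.v *)
From HB Require Import structures.
From mathcomp Require Import all_boot all_algebra.

Set Implicit Arguments.
Unset Strict Implicit.
Unset Printing Implicit Defensive.

Import GRing.Theory.
Local Open Scope ring_scope.

Definition hom_associator (K : fieldType) (A : lmodType K)
    (mu : {bilinear A -> A -> A}) (alpha : {linear A -> A}) (x y z : A) : A :=
  mu (mu x y) (alpha z) - mu (alpha x) (mu y z).

Record hom_center_symmetric (K : fieldType) (A : lmodType K)
    (mu : {bilinear A -> A -> A}) (alpha : {linear A -> A}) : Prop := {
  hcs_mult : forall x y, alpha (mu x y) = mu (alpha x) (alpha y);
  hcs_center_symmetric : forall x y z,
    hom_associator mu alpha x y z = hom_associator mu alpha z y x
}.

(* A linear map l : A -> gl(V) is represented by the bilinear map
   (x, v) |-> l_x v; the endomorphism l_x of V is the partial application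
   [l x]. *)
Record hom_bimodule (K : fieldType) (A V : lmodType K)
    (mu : {bilinear A -> A -> A}) (alpha : {linear A -> A})
    (l r : {bilinear A -> V -> V}) (phi : {linear V -> V}) : Prop := {
  bimod_twistl : forall x, phi \o l x =1 l (alpha x) \o phi;
  bimod_twistr : forall x, phi \o r x =1 r (alpha x) \o phi;
  bimod_lr : forall x y,
    (l (alpha x) \o l y) \- (l (mu x y) \o phi)
    =1 (r (mu y x) \o phi) \- (r (alpha x) \o r y);
  bimod_center : forall x y,
    (l (alpha x) \o r y) \- (r (alpha y) \o l x)
    =1 (l (alpha y) \o r x) \- (r (alpha x) \o l y)
}.

(* Main.v *)
(* The data are invariant under exchanging A and B, so only the A-component of
   the associator of A + B has to be shown symmetric. Sorted by which arguments
   lie in A and which in B, its terms are paired by the exchange of the outer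
   arguments, and each pair matches one axiom: (A,A,A) is center-symmetry of A;
   (B,A,A) with (A,A,B) is compat1; (A,B,A) is compat2; (B,B,A) with (A,B,B) and
   (B,A,B) are the two quadratic bimodule axioms. *)

Require Import Defs.
From HB Require Import structures.
From mathcomp Require Import all_boot all_algebra.

Import GRing.Theory.
Local Open Scope ring_scope.

(** The arguments interleave as pairs [(x, a)] and [(y, b)], so exchanging [A] and [B] turns this
    component of the product into the other one; every lemma below is thus applied twice. *)
Definition matched_comp {K : fieldType} {A B : lmodType K}
    (mu : {bilinear A -> A -> A}) (l r : {bilinear B -> A -> A})
    (x : A) (a : B) (y : A) (b : B) : A :=
  mu x y + l a y + r b x.

Section MatchedComponent.

Context {K : fieldType} {A B : lmodType K}.
Context {muA : {bilinear A -> A -> A}} {alphaA : {linear A -> A}}.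
Context {muB : {bilinear B -> B -> B}} {alphaB : {linear B -> B}}.
Context {lA rA : {bilinear A -> B -> B}} {lB rB : {bilinear B -> A -> A}}.

Local Notation compA := (matched_comp muA lB rB).
Local Notation compB := (fun x a y b => matched_comp muB lA rA a x b y).

Lemma matched_comp_linearl k x a x' a' y b :
  compA (k *: x + x') (k *: a + a') y b
  = k *: compA x a y b + compA x' a' y b.
Proof.
rewrite /matched_comp !linearPl linearP !scalerDr.
by rewrite !addrA [LHS](ACl (1*3*5*2*4*6)%AC).
Qed.

Lemma matched_comp_linearr k x a y b y' b' :
  compA x a (k *: y + y') (k *: b + b')
  = k *: compA x a y b + compA x a y' b'.
Proof.
rewrite /matched_comp !linearP linearPl !scalerDr.
by rewrite !addrA [LHS](ACl (1*3*5*2*4*6)%AC).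
Qed.

Hypothesis hA : hom_center_symmetric muA alphaA.
Hypothesis bimodB : hom_bimodule muB alphaB lB rB alphaA.

(** The twist axioms of the bimodule carry [alphaA] through the two action terms. *)
Lemma matched_comp_mult x a y b :
  alphaA (compA x a y b)
  = compA (alphaA x) (alphaB a) (alphaA y) (alphaB b).
Proof.
have [multA _] := hA; have [twl twr _ _] := bimodB.
rewrite /matched_comp !linearD multA.
by congr (_ + _ + _); [exact: twl | exact: twr].
Qed.

Hypothesis compat_l : forall (x y : A) (a : B),
    muA (lB a x) (alphaA y) + lB (rA x a) (alphaA y)
    - lB (alphaB a) (muA x y) - rB (alphaB a) (muA y x)
    + muA (alphaA y) (rB a x) + rB (lA x a) (alphaA y) = 0.
Hypothesis compat_m : forall (x y : A) (a : B),
    muA (rB a x) (alphaA y) + lB (lA x a) (alphaA y)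
    - muA (alphaA x) (lB a y) - rB (rA y a) (alphaA x)
    - muA (rB a y) (alphaA x) - lB (lA y a) (alphaA x)
    + muA (alphaA y) (lB a x) + rB (rA x a) (alphaA y) = 0.

(** The [A]-component of the hom-associator of [x + a], [y + b], [z + c]. *)
Let assA x a y b z c :=
  compA (compA x a y b) (compB x a y b) (alphaA z) (alphaB c)
  - compA (alphaA x) (alphaB a) (compA y b z c) (compB y b z c).

(* Each summand collects the terms of the associator that are trilinear in one
   choice of arguments, one from each of the pairs (x, a), (y, b), (z, c). *)
Lemma matched_assocE x a y b z c :
  assA x a y b z c =
    hom_associator muA alphaA x y z
    + (muA (lB a y) (alphaA z) + lB (rA y a) (alphaA z)
       - lB (alphaB a) (muA y z))
    + (rB (alphaB c) (muA x y) - muA (alphaA x) (rB c y)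
       - rB (lA y c) (alphaA x))
    + (muA (rB b x) (alphaA z) + lB (lA x b) (alphaA z)
       - muA (alphaA x) (lB b z) - rB (rA z b) (alphaA x))
    + (lB (muB a b) (alphaA z) - lB (alphaB a) (lB b z))
    + (rB (alphaB c) (rB b x) - rB (muB b c) (alphaA x))
    + (rB (alphaB c) (lB a y) - lB (alphaB a) (rB c y)).
Proof.
rewrite /assA /matched_comp /hom_associator !linearD !linearDl /= !opprD !addrA.
by rewrite [LHS](ACl (1*10*2*6*13*7*12*17*3*5*11*18*4*14*9*16*8*15)%AC).
Qed.

Lemma matched_assoc_sym x a y b z c :
  assA x a y b z c = assA z c y b x a.
Proof.
have [_ symA] := hA; have [_ _ blr bc] := bimodB.
(* [compat_l] split in two: the (B,A,A) summand at [(d, u, v)] is the (A,A,B) summand at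
   [(v, u, d)]. *)
have outer u v d :
    muA (lB d u) (alphaA v) + lB (rA u d) (alphaA v) - lB (alphaB d) (muA u v)
    = rB (alphaB d) (muA v u) - muA (alphaA v) (rB d u)
      - rB (lA u d) (alphaA v).
  by apply/subr0_eq; rewrite -[RHS](compat_l u v d) !opprD !opprK !addrA.
have mid u v d :
    muA (rB d u) (alphaA v) + lB (lA u d) (alphaA v)
      - muA (alphaA u) (lB d v) - rB (rA v d) (alphaA u)
    = muA (rB d v) (alphaA u) + lB (lA v d) (alphaA u)
      - muA (alphaA v) (lB d u) - rB (rA u d) (alphaA v).
  by apply/subr0_eq; rewrite -[RHS](compat_m u v d) !opprD !opprK !addrA.
(* The bimodule axioms carry the opposite signs to the associator, so this identity and the next are
   negated first. *)
have lr d e u :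
    lB (muB d e) (alphaA u) - lB (alphaB d) (lB e u)
    = rB (alphaB d) (rB e u) - rB (muB e d) (alphaA u).
  by apply: oppr_inj; rewrite !opprB; exact: blr.
have cent d e u :
    rB (alphaB e) (lB d u) - lB (alphaB d) (rB e u)
    = rB (alphaB d) (lB e u) - lB (alphaB e) (rB d u).
  by apply: oppr_inj; rewrite !opprB; exact: bc.
(* Reversing the outer arguments swaps the second summand with the third and the fifth with the
   sixth, and fixes the types of the others; the final permutation undoes these swaps. *)
rewrite !matched_assocE symA (outer y z a) -(outer y x c) (mid x z b).
rewrite (lr a b z) -(lr c b x) (cent a c y).
by rewrite [LHS](ACl (1*3*2*4*6*5*7)%AC).
Qed.

End MatchedComponent.

Theorem theorem3p8 (K : fieldType) (A B : lmodType K)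
  (muA : {bilinear A -> A -> A}) (alphaA : {linear A -> A})
  (muB : {bilinear B -> B -> B}) (alphaB : {linear B -> B})
  (lA rA : {bilinear A -> B -> B}) (lB rB : {bilinear B -> A -> A})
  (hA : hom_center_symmetric muA alphaA)
  (hB : hom_center_symmetric muB alphaB)
  (bimodA : hom_bimodule muA alphaA lA rA alphaB)
  (bimodB : hom_bimodule muB alphaB lB rB alphaA)
  (compat1 : forall (x y : A) (a : B),
    muA (lB a x) (alphaA y) + lB (rA x a) (alphaA y)
    - lB (alphaB a) (muA x y) - rB (alphaB a) (muA y x)
    + muA (alphaA y) (rB a x) + rB (lA x a) (alphaA y) = 0)
  (compat2 : forall (x y : A) (a : B),
    muA (rB a x) (alphaA y) + lB (lA x a) (alphaA y)
    - muA (alphaA x) (lB a y) - rB (rA y a) (alphaA x)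
    - muA (rB a y) (alphaA x) - lB (lA y a) (alphaA x)
    + muA (alphaA y) (lB a x) + rB (rA x a) (alphaA y) = 0)
  (compat3 : forall (x : A) (a b : B),
    muB (lA x a) (alphaB b) + lA (rB a x) (alphaB b)
    - lA (alphaA x) (muB a b) - rA (alphaA x) (muB b a)
    + muB (alphaB b) (rA x a) + rA (lB a x) (alphaB b) = 0)
  (compat4 : forall (x : A) (a b : B),
    muB (rA x a) (alphaB b) + lA (lB a x) (alphaB b)
    - muB (alphaB a) (lA x b) - rA (rB b x) (alphaB a)
    - muB (rA x b) (alphaB a) - lA (lB b x) (alphaB a)
    + muB (alphaB b) (lA x a) + rA (rB a x) (alphaB b) = 0) :
  exists (star : {bilinear (A * B) -> (A * B) -> (A * B)})
         (alpha : {linear (A * B)%type -> (A * B)%type}),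
    [/\ forall (x y : A) (a b : B),
          star (x, a) (y, b) = (muA x y + lB a y + rB b x,
                                muB a b + lA x b + rA y a),
        forall (x : A) (a : B), alpha (x, a) = (alphaA x, alphaB a)
      & hom_center_symmetric star alpha].
Proof.
pose star (u v : A * B) : A * B :=
  (matched_comp muA lB rB u.1 u.2 v.1 v.2,
   matched_comp muB lA rA u.2 u.1 v.2 v.1).
pose alpha (u : A * B) : A * B := (alphaA u.1, alphaB u.2).
have star_bilinear : bilinear_for
    (GRing.Scale.Law.clone _ _ *:%R _) (GRing.Scale.Law.clone _ _ *:%R _) star.
  split=> [w|w] k u v.
    by congr pair; exact: matched_comp_linearl.
  by congr pair; exact: matched_comp_linearr.
have alpha_linear : linear alpha.
  by move=> k u v; congr pair; exact: linearP.
pose starM := bilinear_isBilinear.Build K _ _ _ _ _ star star_bilinear.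
pose alphaM := GRing.isLinear.Build K _ _ _ alpha alpha_linear.
pose starB : {bilinear (A * B) -> (A * B) -> (A * B)} :=
  HB.pack star starM.
pose alphaL : {linear (A * B)%type -> (A * B)%type} :=
  HB.pack alpha alphaM.
exists starB, alphaL; split=> //; split=> [u v|u v w].
  congr pair; [exact: (matched_comp_mult hA bimodB)|].
  exact: (matched_comp_mult hB bimodA).
congr pair; first exact: (matched_assoc_sym hA bimodB compat1 compat2).
(* With [A] and [B] exchanged, the required conditions quantify over the element of [A] last, while
   [compat3] and [compat4] take it first. *)
by apply: (matched_assoc_sym hB bimodA) => ? ? ?;
  [exact: compat3 | exact: compat4].
Qed.
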